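(* For every positive integer $k$, the number of pairwise non-isomorphic graphs $G$ with $D(G)\le k$ does not exceed $\mathit{Tower}(k+\log^*k+2)$.
   Context: Graphs are finite, simple, undirected, with non-empty vertex set. First-order sentences about graphs have variables ranging over vertices, relation symbols $\sim$ (adjacency) and $=$ (equality), Boolean connectives and quantifiers $\exists,\forall$. The quantifier depth of a sentence is the maximum length of a chain of nested quantifiers. A sentence defines a graph $G$ if it is true on $G$ and false on every graph not isomorphic to $G$. $D(G)$ is the minimum quantifier depth of a sentence defining $G$. $\mathit{Tower}(0)=1$, $\mathit{Tower}(i)=2^{\mathit{Tower}(i-1)}$; $\log^*n=\min\{i:\mathit{Tower}(i)\ge n\}$. *)

(* Defs.v *)
From mathcomp Require Import all_boot.
From mathcomp Require Import boolp.

Set Implicit Arguments.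
Unset Strict Implicit.
Unset Printing Implicit Defensive.

Record graph := Graph {
  vertex :> finType;
  adj : rel vertex;
  adj_sym : symmetric adj;
  adj_irr : irreflexive adj;
  vertex_gt0 : 0 < #|vertex| }.

Definition isomorphic (G H : graph) : Prop :=
  exists f : G -> H, bijective f /\ {mono f : x y / adj x y}.

(* Variables are named by natural numbers. *)
Inductive formula : Type :=
  | FAdj of nat & nat
  | FEq of nat & nat
  | FNot of formula
  | FAnd of formula & formula
  | FOr of formula & formula
  | FImp of formula & formula
  | FEx of nat & formula
  | FAll of nat & formula.

Fixpoint free_vars (phi : formula) : seq nat :=
  match phi with
  | FAdj x y | FEq x y => [:: x; y]
  | FNot p => free_vars p
  | FAnd p q | FOr p q | FImp p q => free_vars p ++ free_vars q
  | FEx x p | FAll x p => [seq y <- free_vars p | y != x]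
  end.

Definition sentence (phi : formula) : bool := nilp (free_vars phi).

Fixpoint qdepth (phi : formula) : nat :=
  match phi with
  | FAdj _ _ | FEq _ _ => 0
  | FNot p => qdepth p
  | FAnd p q | FOr p q | FImp p q => maxn (qdepth p) (qdepth q)
  | FEx _ p | FAll _ p => (qdepth p).+1
  end.

Definition update (T : Type) (e : nat -> T) (x : nat) (v : T) : nat -> T :=
  fun y => if y == x then v else e y.

Fixpoint sat (G : graph) (e : nat -> G) (phi : formula) : bool :=
  match phi with
  | FAdj x y => adj (e x) (e y)
  | FEq x y => e x == e y
  | FNot p => ~~ sat e p
  | FAnd p q => sat e p && sat e q
  | FOr p q => sat e p || sat e q
  | FImp p q => sat e p ==> sat e q
  | FEx x p => [exists v, sat (update e x v) p]
  | FAll x p => [forall v, sat (update e x v) p]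
  end.

(* The truth value of a sentence does not depend on the assignment, and there
   is at least one assignment because graphs are non-empty. *)
Definition true_on (G : graph) (phi : formula) : Prop :=
  forall e : nat -> G, sat e phi.

Definition defines (phi : formula) (G : graph) : Prop :=
  [/\ sentence phi, true_on G phi &
      forall H : graph, ~ isomorphic H G -> ~ true_on H phi].

Definition defining_depth (G : graph) : pred nat :=
  fun d => `[< exists2 phi, defines phi G & qdepth phi = d >].

(* Every graph on n vertices is defined by a sentence of depth n + 1 listing
   its vertices and its adjacencies; the minimum below therefore exists. *)
Section DefinableGraph.

Let big_and (s : seq formula) := foldr FAnd (FEq 0 0) s.
Let big_or (s : seq formula) := foldr FOr (FNot (FEq 0 0)) s.
Let exs (n : nat) (phi : formula) := foldr FEx phi (iota 0 n).

Let sat_and (G : graph) (e : nat -> G) s : sat e (big_and s) = all (sat e) s.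
Proof. by elim: s => [|p s IH] /=; rewrite ?eqxx // IH. Qed.

Let sat_or (G : graph) (e : nat -> G) s : sat e (big_or s) = has (sat e) s.
Proof. by elim: s => [|p s IH] /=; rewrite ?eqxx // IH. Qed.

Let sat_exs (G : graph) (e : nat -> G) n phi :
  sat e (exs n phi) <->
  exists e' : nat -> G, (forall i, n <= i -> e' i = e i) /\ sat e' phi.
Proof.
have gen s : sat e (foldr FEx phi s) <->
    exists e' : nat -> G, (forall i, i \notin s -> e' i = e i) /\ sat e' phi.
  elim: s e => [|x s IH] e /=.
    split=> [h|[e' [h1 h2]]]; first by exists e.
    by have <- : e' = e by apply/funext => i; apply: h1.
  split.
    case/existsP=> v /IH[e' [h1 h2]]; exists e'; split=> // i.
    rewrite inE negb_or => /andP[ix /h1->].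
    by rewrite /update (negPf ix).
  case=> e' [h1 h2]; apply/existsP; exists (e' x); apply/IH; exists e'.
  split=> // i nis; rewrite /update; case: eqP => [->//|/eqP ix].
  by apply: h1; rewrite inE negb_or ix.
rewrite /exs gen; split=> -[e' [h1 h2]]; exists e'; split=> // i hi; apply: h1.
  by rewrite mem_iota add0n -leqNgt.
by move: hi; rewrite mem_iota add0n -leqNgt.
Qed.

Let fv_and (P : pred nat) s : P 0 ->
  all (fun p => all P (free_vars p)) s -> all P (free_vars (big_and s)).
Proof.
by move=> P0; elim: s => [|p s IH] /=; rewrite ?P0 // all_cat => /andP[-> /IH].
Qed.

Let fv_or (P : pred nat) s : P 0 ->
  all (fun p => all P (free_vars p)) s -> all P (free_vars (big_or s)).
Proof.
by move=> P0; elim: s => [|p s IH] /=; rewrite ?P0 // all_cat => /andP[-> /IH].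
Qed.

Let fv_exs n phi y :
  (y \in free_vars (exs n phi)) = (y \in free_vars phi) && (n <= y).
Proof.
have gen s : (y \in free_vars (foldr FEx phi s)) =
    (y \in free_vars phi) && (y \notin s).
  elim: s => [|x s IH] /=; first by rewrite andbT.
  by rewrite mem_filter IH inE negb_or andbCA.
by rewrite gen mem_iota add0n -leqNgt.
Qed.

Lemma defining_depth_ex (G : graph) : exists d, defining_depth G d.
Proof.
pose n := #|G|.
have n_gt0 : 0 < n by apply: vertex_gt0.
have [v0 _] : exists v : G, v \in G by apply/card_gt0P.
pose v i := nth v0 (enum G) i.
have v_inj i j : i < n -> j < n -> (v i == v j) = (i == j).
  by move=> hi hj; rewrite nth_uniq -?cardE ?enum_uniq.
have v_sur x : exists2 i, i < n & v i = x.
  exists (index x (enum G)); last by rewrite /v nth_index // mem_enum.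
  by rewrite /n cardE index_mem mem_enum.
pose lit i j := FAnd (if i == j then FEq i j else FNot (FEq i j))
                     (if adj (v i) (v j) then FAdj i j else FNot (FAdj i j)).
pose pat := big_and [seq lit i j | i <- iota 0 n, j <- iota 0 n].
pose cov := FAll n (big_or [seq FEq n i | i <- iota 0 n]).
pose phi := exs n (FAnd pat cov).
have sat_lit (H : graph) (e : nat -> H) i j : sat e (lit i j) =
    ((e i == e j) == (i == j)) && (adj (e i) (e j) == adj (v i) (v j)).
  rewrite /lit /=; congr andb; first by case: (i == j) => /=; case: (e i == e j).
  by case: (adj (v i) (v j)) => /=; case: (adj (e i) (e j)).
have sat_pat (H : graph) (e : nat -> H) : reflect (forall i j, i < n -> j < n ->
    (e i == e j) = (i == j) /\ adj (e i) (e j) = adj (v i) (v j)) (sat e pat).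
  rewrite sat_and; apply: (iffP all_allpairsP) => h i j; last first.
    rewrite !mem_iota => hi hj; rewrite sat_lit.
    by have [-> ->] := h i j hi hj; rewrite !eqxx.
  move=> hi hj; have := h i j; rewrite !mem_iota => /(_ hi hj).
  by rewrite sat_lit => /andP[/eqP-> /eqP->].
have sat_cov (H : graph) (e : nat -> H) : reflect
    (forall x, exists2 i, i < n & e i = x) (sat e cov).
  have -> : sat e cov = [forall x, has (fun i => x == e i) (iota 0 n)].
    apply: eq_forallb => x.
    rewrite -[LHS]/(sat (update e n x) (big_or [seq FEq n i | i <- iota 0 n])).
    rewrite sat_or has_map; apply: eq_in_has => i.
    by rewrite mem_iota /= add0n => hi; rewrite /update eqxx (ltn_eqF hi).
  apply: (iffP forallP) => h x.
    have /hasP[i] := h x; rewrite mem_iota => hi /eqP->; by exists i.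
  have [i hi ex] := h x; apply/hasP; exists i; last by rewrite ex.
  by rewrite mem_iota.
exists (qdepth phi); apply/asboolP; exists phi => //; split.
- rewrite /sentence; case E : (free_vars phi) => [//|y s].
  have : y \in free_vars phi by rewrite E mem_head.
  rewrite fv_exs => /andP[+ ny].
  suff /allP h : all (fun z => z < n) (free_vars (FAnd pat cov)).
    by move=> /h; rewrite ltnNge ny.
  rewrite /= all_cat fv_and //=.
    rewrite all_filter.
    apply: (sub_all (a1 := fun z => z < n.+1)).
      by move=> z /=; rewrite ltnS [z <= n]leq_eqVlt; case: eqP.
    apply: fv_or => //; rewrite all_map; apply/allP=> i.
    by rewrite mem_iota /= add0n => hi; rewrite ltnSn ltnS (ltnW hi).
  apply/all_allpairsP=> i j; rewrite !mem_iota /= !add0n => hi hj.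
  by rewrite all_cat; case: ifP => _; case: ifP => _ /=; rewrite hi hj.
- move=> e; apply/sat_exs; exists (fun i => if i < n then v i else e i).
  split=> [i|]; first by rewrite leqNgt => /negPf->.
  apply/andP; split.
    by apply/sat_pat => i j hi hj; rewrite hi hj v_inj.
  by apply/sat_cov => x; have [i hi <-] := v_sur x; exists i; rewrite ?hi.
- move=> H nHG tH; apply: nHG.
  have [w0 _] : exists w : H, w \in H by apply/card_gt0P/vertex_gt0.
  have /sat_exs[e [_ /andP[/sat_pat hp /sat_cov hc]]] := tH (fun _ => w0).
  have [g hg] : exists g : H -> nat, forall x, g x < n /\ e (g x) = x.
    exists (fun x => index x (mkseq e n)) => x; have [i hi ei] := hc x.
    have xs : x \in mkseq e n by apply/mapP; exists i; rewrite ?mem_iota.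
    have ix : index x (mkseq e n) < n by rewrite -{2}(size_mkseq e n) index_mem.
    by rewrite -(nth_mkseq x e ix) nth_index.
  exists (v \o g); split.
    exists (fun x => e (index x (enum G))) => x /=.
      have [gx egx] := hg x.
      by rewrite /v index_uniq ?enum_uniq -?cardE.
    have ix : index x (enum G) < n by rewrite /n cardE index_mem mem_enum.
    set i := index x _ in ix *; have [ge eg] := hg (e i).
    have /eqP : g (e i) == i by have [<- _] := hp _ _ ge ix; rewrite eg.
    by move->; rewrite /v nth_index // mem_enum.
  move=> x y /=; have [gx ex] := hg x; have [gy ey] := hg y.
  by have [_ <-] := hp _ _ gx gy; rewrite ex ey.
Qed.

End DefinableGraph.

Definition D (G : graph) : nat := ex_minn (defining_depth_ex G).

Fixpoint tower (i : nat) : nat := if i is j.+1 then 2 ^ tower j else 1.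

Lemma tower_unbounded (n : nat) : exists i, n <= tower i.
Proof.
exists n; elim: n => //= n IH.
by apply: (leq_ltn_trans IH); apply: ltn_expl.
Qed.

Definition log_star (n : nat) : nat := ex_minn (tower_unbounded n).

(* Main.v *)
Require Import Defs.
From mathcomp Require Import all_boot.
From mathcomp Require Import boolp.

Set Implicit Arguments.
Unset Strict Implicit.
Unset Printing Implicit Defensive.

(** A sentence of quantifier depth at most [k] only sees the rank-[k] type of a
    graph (the Ehrenfeucht-Fraisse game of length [k]), so two non-isomorphic
    graphs of defining depth at most [k] have different types.  A type of rank 0
    is the equality and adjacency pattern of a [k]-tuple, given by [k (k - 1)]
    bits, and a type of rank [r + 1] is a set of types of rank [r].  As
    [k (k - 1) <= 2 ^ k], the number of types of rank [k] is at most
    [2 ^ k <= tower (log_star k + 1)] exponentiated [k + 1] times. *)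

Fixpoint rank_type (k r : nat) : finType :=
  if r is r'.+1 then {set rank_type k r'} else {set 'I_k * 'I_k.-1}.

(* A pair [(i, j)] stands for the ordered pair of distinct indices
   [(i, lift i j)]; the two orders of a pair of indices carry its two bits, the
   increasing one for equality and the decreasing one for adjacency. *)
Definition atomic_type (k : nat) (G : graph) (s : nat -> G) :
    {set 'I_k * 'I_k.-1} :=
  [set p | let i := p.1 in let j := lift i p.2 in
           if i < j then s i == s j else adj (s i) (s j)].

(* The type of the tuple [s 0, ..., s (n - 1)]; in all uses [n + r <= k]. *)
Fixpoint type_of (k : nat) (G : graph) (r n : nat) (s : nat -> G) :
    rank_type k r :=
  match r return rank_type k r with
  | 0 => atomic_type k s
  | r'.+1 => [set type_of k r' n.+1 (update s n v) | v in G]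
  end.

Lemma update_eq (T : Type) (s : nat -> T) n v : update s n v n = v.
Proof. by rewrite /update eqxx. Qed.

Lemma update_neq (T : Type) (s : nat -> T) n v i :
  i != n -> update s n v i = s i.
Proof. by rewrite /update => /negPf->. Qed.

(** A type of positive rank is the set of types of all one-vertex extensions, so each move in [G]
    has an answer in [H]. *)
Lemma type_of_forth (k : nat) (G H : graph) r n (s : nat -> G) (s' : nat -> H) :
  type_of k r.+1 n s = type_of k r.+1 n s' ->
  forall v, exists w,
    type_of k r n.+1 (update s n v) = type_of k r n.+1 (update s' n w).
Proof.
move=> /= /setP eq_s v.
have := eq_s (type_of k r n.+1 (update s n v)).
by rewrite imset_f // => /esym/imsetP[w _ ->]; exists w.
Qed.

(** The diagonal needs no bit: there equality always holds and adjacency never does. *)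
Lemma atomic_type_inj (k : nat) (G H : graph) (s : nat -> G) (s' : nat -> H) :
  atomic_type k s = atomic_type k s' -> forall i j, i < k -> j < k ->
  (s i == s j) = (s' i == s' j) /\ adj (s i) (s j) = adj (s' i) (s' j).
Proof.
move=> /setP eq_s.
have bit i j (ik : i < k) (jk : j < k) : i != j ->
    (if i < j then s i == s j else adj (s i) (s j)) =
    (if i < j then s' i == s' j else adj (s' i) (s' j)).
  move=> neq_ij; have neq : Ordinal ik != Ordinal jk by [].
  have [j' def_j _] := unlift_some neq.
  have val_j : j = bump i j' := congr1 val def_j.
  by have := eq_s (Ordinal ik, j'); rewrite !inE /= -val_j.
have lt_case i j : i < j -> j < k ->
    (s i == s j) = (s' i == s' j) /\ adj (s i) (s j) = adj (s' i) (s' j).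
  move=> ij jk; have ik := ltn_trans ij jk.
  have := bit i j ik jk; have := bit j i jk ik.
  rewrite ij ltnNge (ltnW ij) /= neq_ltn ij orbT neq_ltn ij /=.
  by move=> /(_ isT) eq_adj /(_ isT) ->; rewrite adj_sym eq_adj adj_sym.
move=> i j ik jk; have [ij|ji|<-] := ltngtP i j; first exact: lt_case.
  have [eq_e eq_a] := lt_case j i ji ik.
  by rewrite eq_sym eq_e eq_sym adj_sym eq_a adj_sym.
by rewrite !eqxx !adj_irr.
Qed.

(** Playing the [r] remaining rounds with arbitrary moves leads to equal atomic types; these moves
    only fill positions from [n] on. *)
Lemma type_of_atomic (k : nat) (G H : graph) r n (s : nat -> G) (s' : nat -> H) :
  n + r <= k -> type_of k r n s = type_of k r n s' ->
  forall i j, i < n -> j < n ->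
  (s i == s j) = (s' i == s' j) /\ adj (s i) (s j) = adj (s' i) (s' j).
Proof.
elim: r n s s' => [|r IH] n s s'.
  rewrite addn0 => nk eq_s i j i_n j_n.
  by apply: (atomic_type_inj eq_s); apply: leq_trans nk.
rewrite addnS -addSn => nk eq_s i j i_n j_n.
have [v _] : exists v : G, v \in G by apply/card_gt0P/vertex_gt0.
have [w eq_vw] := type_of_forth eq_s v.
have := IH _ _ _ nk eq_vw i j (ltnW i_n) (ltnW j_n).
by rewrite !update_neq ?ltn_eqF.
Qed.

(* [a] locates the value of each free variable in the tuples [s] and [s']. *)
Lemma type_of_sat (k : nat) (G H : graph) (phi : formula) r n (s : nat -> G)
    (s' : nat -> H) (e : nat -> G) (e' : nat -> H) (a : nat -> nat) :
  qdepth phi <= r -> n + r <= k -> type_of k r n s = type_of k r n s' ->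
  {in free_vars phi, forall x, [/\ a x < n, e x = s (a x) & e' x = s' (a x)]} ->
  sat e phi = sat e' phi.
Proof.
(* Common to both quantifiers: the value of [x] is placed at position [n'], where [update b x n']
   locates it; the other variables sit below [n'], untouched. *)
have step x p r' n' (t : nat -> G) (t' : nat -> H) (f : nat -> G)
    (f' : nat -> H) (b : nat -> nat) v w :
    (forall r n s s' e e' a, qdepth p <= r -> n + r <= k ->
       type_of k r n s = type_of k r n s' ->
       {in free_vars p, forall x,
         [/\ a x < n, e x = s (a x) & e' x = s' (a x)]} ->
       @sat G e p = @sat H e' p) ->
    qdepth p <= r' -> n' + r'.+1 <= k ->
    type_of k r' n'.+1 (update t n' v) = type_of k r' n'.+1 (update t' n' w) ->
    {in [seq y <- free_vars p | y != x], forall y,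
      [/\ b y < n', f y = t (b y) & f' y = t' (b y)]} ->
    sat (update f x v) p = sat (update f' x w) p.
  move=> IH dp nk eq_t loc.
  apply: (IH r' n'.+1 _ _ _ _ (update b x n') dp _ eq_t).
    by rewrite addSnnS.
  move=> y yp; have [->|yx] := eqVneq y x; first by rewrite !update_eq.
  have [|by_n fy f'y] := loc y; first by rewrite mem_filter yx.
  by rewrite !(update_neq _ _ yx) !update_neq ?ltn_eqF // ltnS (ltnW by_n).
elim: phi r n s s' e e' a => [x y|x y|p IH|p IHp q IHq|p IHp q IHq|p IHp q IHq|
    x p IH|x p IH] r n s s' e e' a.
- move=> _ nk eq_s loc /=.
  have [ax -> ->] := loc x (mem_head _ _).
  have [ay -> ->] : [/\ a y < n, e y = s (a y) & e' y = s' (a y)].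
    by apply: loc; rewrite !inE eqxx orbT.
  by case: (type_of_atomic nk eq_s ax ay).
- move=> _ nk eq_s loc /=.
  have [ax -> ->] := loc x (mem_head _ _).
  have [ay -> ->] : [/\ a y < n, e y = s (a y) & e' y = s' (a y)].
    by apply: loc; rewrite !inE eqxx orbT.
  by case: (type_of_atomic nk eq_s ax ay).
- by move=> /= dp nk eq_s loc; rewrite (IH r n s s' e e' a).
- rewrite /= geq_max => /andP[dp dq] nk eq_s loc.
  by rewrite (IHp r n s s' e e' a) ?(IHq r n s s' e e' a) // => x xs;
    apply: loc; rewrite mem_cat xs ?orbT.
- rewrite /= geq_max => /andP[dp dq] nk eq_s loc.
  by rewrite (IHp r n s s' e e' a) ?(IHq r n s s' e e' a) // => x xs;
    apply: loc; rewrite mem_cat xs ?orbT.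
- rewrite /= geq_max => /andP[dp dq] nk eq_s loc.
  by rewrite (IHp r n s s' e e' a) ?(IHq r n s s' e e' a) // => x xs;
    apply: loc; rewrite mem_cat xs ?orbT.
- case: r => // r dp nk eq_s loc /=; apply/existsP/existsP => -[v sat_v].
    have [w eq_vw] := type_of_forth eq_s v; exists w.
    by rewrite -(step x p r n s s' e e' a v w).
  have [w eq_vw] := type_of_forth (esym eq_s) v; exists w.
  by rewrite (step x p r n s s' e e' a w v).
- case: r => // r dp nk eq_s loc /=; apply/forallP/forallP => sat_p v.
    have [w eq_vw] := type_of_forth (esym eq_s) v.
    by rewrite -(step x p r n s s' e e' a w v).
  have [w eq_vw] := type_of_forth eq_s v.
  by rewrite (step x p r n s s' e e' a v w).
Qed.

Lemma type_of_isomorphic (k : nat) (G H : graph) (s : nat -> G) (s' : nat -> H) :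
  D G <= k -> type_of k k 0 s = type_of k k 0 s' -> isomorphic H G.
Proof.
rewrite /D; case: ex_minnP => d /asboolP[phi [sent_phi true_phi only_phi] <-] _.
move=> dk eq_s; apply: contrapT => /only_phi; apply=> e'.
(* Without free variables there is nothing to locate, so the empty tuple and the map [id]
   suffice. *)
rewrite -(@type_of_sat k G H phi k 0 s s' s e' id) //.
by move=> x; rewrite (nilP sent_phi).
Qed.

Lemma leq_mul_pred_exp2 k : k * k.-1 <= 2 ^ k.
Proof.
(* Passing from [n] to [n + 1] uses [n + 1 <= 2 * (n - 1)], so the induction starts at 3. *)
case: k => [|[|[|k]]] //; elim: k => // k IH.
rewrite expnS mul2n -addnn; apply: leq_trans (leq_add IH IH).
rewrite -mulnDr mulnC leq_mul2l /=.
by rewrite !addSn !addnS !ltnS leq_addr.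
Qed.

Lemma leq_tower_log_star k : k <= tower (log_star k).
Proof. by rewrite /log_star; case: ex_minnP. Qed.

Lemma card_rank_type k r : #|rank_type k r| <= tower (r + log_star k + 2).
Proof.
have card_sets (T : finType) : #|{set T}| = 2 ^ #|T|.
  by rewrite -[LHS]cardsT -powersetT card_powerset cardsT.
rewrite addn2; elim: r => [|r IH].
  (* The two extra tower levels: one for the subsets of the index pairs, one for
     [k * k.-1 <= 2 ^ k]. *)
  rewrite card_sets card_prod !card_ord leq_exp2l //.
  apply: leq_trans (leq_mul_pred_exp2 k) _.
  by rewrite leq_exp2l // leq_tower_log_star.
by rewrite card_sets addSn leq_exp2l.
Qed.

Theorem theorem2p3 (k : nat) (k_gt0 : 0 < k) (m : nat) (G : 'I_m -> graph)
    (D_le : forall i : 'I_m, D (G i) <= k)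
    (noniso : forall i j : 'I_m, i != j -> ~ isomorphic (G i) (G j)) :
  m <= tower (k + log_star k + 2).
Proof.
have vtx i : exists v : G i, v \in G i by apply/card_gt0P/vertex_gt0.
(* The chosen vertex is mere padding: the [k] rounds overwrite every position below [k]. *)
pose t i := type_of k k 0 (fun=> xchoose (vtx i)).
suff t_inj : injective t.
  rewrite -[m]card_ord.
  exact: leq_trans (leq_card t t_inj) (card_rank_type k k).
move=> i j eq_t; apply/eqP; apply: contraT; rewrite eq_sym => /noniso[].
exact: type_of_isomorphic (D_le i) eq_t.
Qed.
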